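(* (Geometrical Theorem.) Apply the Smallest Vector Algorithm to $\mathbf X$, and let $\mathbf H'^{(s)}=\mathrm{conv}\{\pm\mathbf g_0^{(s)\prime},\pm\mathbf g_1^{(s)\prime},\pm\mathbf g_2^{(s)\prime}\}\subset\mathbb P$. Let $\rho^{(s)}$ be the radius of the largest disk in $\mathbb P$ with center $\mathbf 0$ contained in $\mathbf H'^{(s)}$. Then there exists an infinite set $S\subset\mathbb N$ such that $$\sup_{s\in S}\frac{\max_{i=0,1,2}\|\mathbf g_i^{(s)\prime}\|}{\rho^{(s)}}<+\infty.$$
   Context: Use the Euclidean norm and inner product $\bullet$ on $\mathbb R^3$. Standing assumption: $\mathbf X={}^{T}(x_0,x_1,x_2)$ is a rationally independent triple of real numbers with $0<x_0<x_1<x_2$. Set $\mathbb D=\mathbb R\mathbf X$ and $\mathbb P=\mathbb D^{\perp}$. For $\mathbf h\in\mathbb R^3$, write $\mathbf h'$ for its orthogonal projection on $\mathbb P$ and $\mathbf h''$ for its orthogonal projection on $\mathbb D$. The Smallest Vector Algorithm (SVA) produces integer $3\times3$ matrices $\mathbf G^{(s)}=(\mathbf g_0^{(s)},\mathbf g_1^{(s)},\mathbf g_2^{(s)})$, given by their columns, as follows. - $\mathbf G^{(0)}=\mathbf I$. - Given $\mathbf G^{(s)}$ (superscripts omitted), let $\Delta_{\min}=\min(\|\mathbf g_1'-\mathbf g_0'\|,\|\mathbf g_2'-\mathbf g_1'\|,\|\mathbf g_2'-\mathbf g_0'\|)$. Define $(\mathbf f_0,\mathbf f_1,\mathbf f_2)$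 by: - $(\mathbf g_0,\mathbf g_1-\mathbf g_0,\mathbf g_2)$ if $\Delta_{\min}=\|\mathbf g_1'-\mathbf g_0'\|$; - $(\mathbf g_0,\mathbf g_1,\mathbf g_2-\mathbf g_1)$ if $\Delta_{\min}=\|\mathbf g_2'-\mathbf g_1'\|$; - $(\mathbf g_0,\mathbf g_1,\mathbf g_2-\mathbf g_0)$ if $\Delta_{\min}=\|\mathbf g_2'-\mathbf g_0'\|$. - $\mathbf G^{(s+1)}$ is any permutation of the columns $\mathbf f_0,\mathbf f_1,\mathbf f_2$ such that $\|\mathbf g_0^{(s+1)\prime\prime}\|\le\|\mathbf g_1^{(s+1)\prime\prime}\|\le\|\mathbf g_2^{(s+1)\prime\prime}\|$. *)

(* Defs.v *)
From HB Require Import structures.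
From mathcomp Require Import all_boot all_order all_algebra all_fingroup.
From mathcomp Require Import all_classical all_reals all_analysis.
Set Implicit Arguments.
Unset Strict Implicit.
Unset Printing Implicit Defensive.
Import Order.TTheory GRing.Theory Num.Theory.
Local Open Scope classical_set_scope.
Local Open Scope ring_scope.

Section SVA.
Variable R : realType.
Implicit Types (u v h X : 'cV[R]_3) (G F : 'M[int]_3).

Definition dot u v : R := \sum_(i < 3) u i 0 * v i 0.

(* The library norm `|v| on matrices is the sup norm, hence this one. *)
Definition enorm v : R := Num.sqrt (dot v v).

Definition rationally_independent X : Prop :=
  forall q : 'I_3 -> rat,
    \sum_(i < 3) ratr (q i) * X i 0 = 0 -> forall i, q i = 0.

Definition planeP X : set 'cV[R]_3 := [set v | dot v X = 0].

(* [projD X h] is h'' and [projP X h] is h' (for X != 0). *)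
Definition projD X h : 'cV[R]_3 := (dot h X / dot X X) *: X.
Definition projP X h : 'cV[R]_3 := h - projD X h.

Definition gcol G (i : 'I_3) : 'cV[R]_3 := col i (map_mx intr G).

Definition gdist X G (i j : 'I_3) : R :=
  enorm (projP X (gcol G i) - projP X (gcol G j)).

Definition delta_min X G : R :=
  Num.min (Num.min (gdist X G 1 0) (gdist X G 2 1)) (gdist X G 2 0).

Definition sub_col (i j : 'I_3) G : 'M[int]_3 :=
  \matrix_(r, c) if c == i then G r i - G r j else G r c.

(* When the minimum is attained more than once, every choice is allowed. *)
Variant sva_subtract X G : 'M[int]_3 -> Prop :=
  | Sva10 : delta_min X G = gdist X G 1 0 -> sva_subtract X G (sub_col 1 0 G)
  | Sva21 : delta_min X G = gdist X G 2 1 -> sva_subtract X G (sub_col 2 1 G)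
  | Sva20 : delta_min X G = gdist X G 2 0 -> sva_subtract X G (sub_col 2 0 G).

Definition sva_step X G G' : Prop :=
  exists (F : 'M[int]_3) (p : 'S_3),
    [/\ sva_subtract X G F,
        G' = col_perm p F,
        enorm (projD X (gcol G' 0)) <= enorm (projD X (gcol G' 1)) &
        enorm (projD X (gcol G' 1)) <= enorm (projD X (gcol G' 2))].

Definition sva_run X (G : nat -> 'M[int]_3) : Prop :=
  G 0%N = 1%:M /\ forall s, sva_step X (G s) (G s.+1).

Definition convex_hull (A : set 'cV[R]_3) : set 'cV[R]_3 :=
  smallest (@convex_set R 'cV[R]_3) A.

Definition hexagon X G : set 'cV[R]_3 :=
  convex_hull [set v | exists i : 'I_3,
    v = projP X (gcol G i) \/ v = - projP X (gcol G i)].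

Definition diskP X (r : R) : set 'cV[R]_3 :=
  planeP X `&` [set v | enorm v <= r].

Definition inradius X G : R :=
  sup [set r : R | 0 <= r /\ diskP X r `<=` hexagon X G].

Definition max_norm X G : R :=
  Num.max (Num.max (enorm (projP X (gcol G 0))) (enorm (projP X (gcol G 1))))
          (enorm (projP X (gcol G 2))).

End SVA.

(* Main.v *)
Require Import Defs.
From HB Require Import structures.
From mathcomp Require Import all_boot all_order all_algebra all_fingroup.
From mathcomp Require Import all_classical all_reals all_analysis.
From mathcomp Require Import ring lra.
Set Implicit Arguments.
Unset Strict Implicit.
Unset Printing Implicit Defensive.
Import Order.TTheory GRing.Theory Num.Theory.
Local Open Scope classical_set_scope.
Local Open Scope ring_scope.

(** The projected columns a, b, c satisfy x a + y b + z c = 0 with positive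
    weights x, y, z, normalised so that each weight is the area of the
    parallelogram spanned by the two other vectors. Replacing a by a - b adds x
    to y, so the total area A = x + y + z increases. Hence L^2 / A, where L is the
    largest norm, can only increase at a step whose shortest side is longer than L.
    When L^2 / A is large this forces a and c to be nearly opposite, of norm nearly
    L, with b short and transverse, and the shortest side exceeds L so little that
    the growth of A compensates it, except when b itself is replaced, say by b - a.
    In that case the next subtraction involves b - a and c: it either restores a
    short vector in place of b - a, or makes A grow enough. So every s with
    L^2 / A <= K (K >= 1000) is followed by another one within two steps, and
    L^2 / A bounds the ratio of L to the inradius up to a constant. *)

(* Gram matrix of three vectors a, b, c of a plane, with weights x, y, z as above. *)
Record planar_gram (R : realFieldType) (aa bb cc ab bc ac x y z : R) : Prop :=
  PlanarGram {
    gram_wa : 0 < x; gram_wb : 0 < y; gram_wc : 0 < z;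
    gram_aa : 0 <= aa; gram_bb : 0 <= bb; gram_cc : 0 <= cc;
    gram_areac : aa * bb - ab * ab = z * z;
    gram_areaa : bb * cc - bc * bc = x * x;
    gram_areab : aa * cc - ac * ac = y * y;
    gram_rela : x * aa + y * ab + z * ac = 0;
    gram_relb : x * ab + y * bb + z * bc = 0;
    gram_relc : x * ac + y * bc + z * cc = 0 }.

(** * Thin planar triples *)

Section PlanarGram.
Context (R : realFieldType).
Implicit Types aa bb cc ab bc ac uu vv uv t e x y z L : R.

Lemma gram_swap_ac aa bb cc ab bc ac x y z :
  planar_gram aa bb cc ab bc ac x y z -> planar_gram cc bb aa bc ab ac z y x.
Proof. by case=> *; split=> //; lra. Qed.

(** The Gram matrix has rank two and kernel spanned by the weights, so its adjugate is the matrix of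
    products of weights; these are the off-diagonal cofactors. Each follows from the relations and
    one area identity after multiplication by a nonzero weight. *)
Lemma gram_cross aa bb cc ab bc ac x y z :
  planar_gram aa bb cc ab bc ac x y z ->
  [/\ bb * ac = ab * bc - x * z, aa * bc = ab * ac - y * z
    & cc * ab = ac * bc - x * y].
Proof.
case=> x0 y0 z0 a0 b0 c0 Ec Ea Eb Ra Rb Rc; split.
- have x0' : x != 0 by lra.
  apply: (mulfI x0'); apply/eqP; rewrite -subr_eq0; apply/eqP.
  rewrite (_ : _ - _ = bb * (x * ac + y * bc + z * cc)
    - bc * (x * ab + y * bb + z * bc) - z * (bb * cc - bc * bc - x * x)); last by ring.
  by rewrite Rc Rb Ea; ring.
- have z0' : z != 0 by lra.
  apply: (mulfI z0'); apply/eqP; rewrite -subr_eq0; apply/eqP.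
  rewrite (_ : _ - _ = aa * (x * ab + y * bb + z * bc)
    - ab * (x * aa + y * ab + z * ac) - y * (aa * bb - ab * ab - z * z)); last by ring.
  by rewrite Ra Rb Ec; ring.
- have x0' : x != 0 by lra.
  apply: (mulfI x0'); apply/eqP; rewrite -subr_eq0; apply/eqP.
  rewrite (_ : _ - _ = cc * (x * ab + y * bb + z * bc)
    - bc * (x * ac + y * bc + z * cc) - y * (bb * cc - bc * bc - x * x)); last by ring.
  by rewrite Rc Rb Ea; ring.
Qed.

Lemma sqr_le_abs t e : 0 <= e -> t * t <= e * e -> - e <= t <= e.
Proof. by move=> e0 te; apply/andP; split; nra. Qed.

(** Since [uv] is at most [uu / 2] and [vv] at least [uu], the Gram determinant is at least
    [3/4 * uu^2]. *)
Lemma acute_flat_short uu vv uv e :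
  0 <= uu -> uu <= vv -> 0 <= uv -> 2 * uv <= uu -> 0 <= e ->
  uu * vv - uv * uv <= e * e -> uu <= 2 * e.
Proof.
move=> u0 uvle p0 pu e0 H.
have h1 : uv * uv <= uu / 2 * (uu / 2) by apply: ler_pM => //; lra.
have h2 : uu * uu <= uu * vv by apply: ler_wpM2l.
have ee : 0 <= e * e by apply: mulr_ge0.
have /andP[] : - (2 * e) <= uu <= 2 * e by apply: sqr_le_abs; lra.
by [].
Qed.

(** Makes b nearly orthogonal to c. A nonnegative [bc] is at most [bb / 2], hence tiny. For a
    negative one, the cross identity bounds [- bc] by a multiple of [bb / 2 + z / 1000], where
    [z^2 <= bb]. *)
Lemma transverse_dot aa bb ab bc ac y z :
  89 / 100 <= aa -> aa <= 1 -> 0 <= bb -> bb <= 2 / 1000 ->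
  2 * ab <= bb -> 2 * bc <= bb -> - 1 <= ac -> ac <= 0 ->
  aa * bb - ab * ab = z * z -> 0 <= y -> y <= 1 / 1000 -> 0 <= z ->
  aa * bc = ab * ac - y * z -> 10 * (bc * bc) <= bb.
Proof.
move=> a9 a1 b0 b2 abb bcb ac1 ac0 Ec y0 y1 z0 E.
have bbb : bb * bb <= bb * (2 / 1000) by apply: ler_wpM2l.
case: (leP 0 bc) => h.
  have : bc * bc <= (bb / 2) * (bb / 2) by clear - h bcb; apply: ler_pM; lra.
  by clear - bbb b0; lra.
have zz : z * z <= bb.
  have : aa * bb <= 1 * bb by apply: ler_wpM2r.
  by have := sqr_ge0 ab; rewrite expr2; clear - Ec; lra.
have h1 : - (ab * ac) <= bb / 2.
  case: (leP 0 ab) => h2.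
    have : ab * (- ac) <= ab * 1 by apply: ler_wpM2l => //; clear - ac1; lra.
    by clear - abb; lra.
  have : 0 <= (- ab) * (- ac) by apply: mulr_ge0; clear - ac0 h2; lra.
  by clear - b0; lra.
have h2 : y * z <= 1 / 1000 * z by apply: ler_wpM2r.
have h3 : 89 / 100 * (- bc) <= aa * (- bc) by apply: ler_wpM2r; clear - a9 h; lra.
have h4 : 89 / 100 * (- bc) <= bb / 2 + 1 / 1000 * z by clear - h1 h2 h3 E; lra.
have h5 : (89 / 100 * (- bc)) * (89 / 100 * (- bc))
    <= (bb / 2 + 1 / 1000 * z) * (bb / 2 + 1 / 1000 * z).
  by clear - h4 h; apply: ler_pM; lra.
by have := sqr_ge0 (bb / 2 - 1 / 1000 * z); rewrite expr2; clear - h5 zz bbb b0; lra.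
Qed.

Lemma flat_dot_small t uu vv x :
  uu * vv - t * t = x * x -> 0 <= uu -> uu <= 2 / 1000 -> 0 <= vv -> vv <= 1 ->
  - (5 / 100) <= t <= 5 / 100.
Proof.
move=> E u0 u1 v0 v1; apply: sqr_le_abs; first by lra.
have : uu * vv <= 2 / 1000 * 1 by apply: ler_pM.
by have := sqr_ge0 x; rewrite expr2; lra.
Qed.

(** If [ac] were positive, flatness would make a short, hence b as well, and then the side a - b
    could not exceed 1. *)
Lemma thin_obtuse aa bb cc ab ac y z :
  aa * bb - ab * ab = z * z -> aa * cc - ac * ac = y * y ->
  0 <= y -> y <= 1 / 1000 -> 0 <= bb -> bb <= aa -> aa <= cc -> aa <= 1 -> cc <= 1 ->
  1 < aa + bb - 2 * ab -> 1 < aa + cc - 2 * ac -> ac <= 0.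
Proof.
move=> Ec Eb y0 y1 b0 ba ac' a1 c1 sab sac.
rewrite leNgt; apply/negP => ac0.
have a2 : aa <= 2 * y by apply: (@acute_flat_short aa cc ac); lra.
have /andP[] : - (5/100) <= ab <= 5/100.
  by apply: (@flat_dot_small ab bb aa z); lra.
lra.
Qed.

(** If b makes an acute angle with a or c, [acute_flat_short] applies. Otherwise the cross identity
    with [ac <= 0] gives [ab * bc <= e^2], so one of [- ab], [- bc] is at most [e], and the
    corresponding area identity bounds [bb^2] by [2 * e^2]. *)
Lemma thin_short aa bb cc ab bc ac x z e :
  aa * bb - ab * ab = z * z -> bb * cc - bc * bc = x * x ->
  bb * ac = ab * bc - x * z -> ac <= 0 ->
  0 <= x -> x <= e -> 0 <= z -> z <= e -> 0 < e ->
  0 <= bb -> bb <= aa -> bb <= cc -> 2 * ab <= bb -> 2 * bc <= bb -> bb <= 2 * e.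
Proof.
move=> Ec Ea K ac0 x0 xe' z0 ze' e0 b0 ba bc' hab2 hbc2.
have xe : x * x <= e * e by apply: ler_pM.
have ze : z * z <= e * e by apply: ler_pM.
have xze : x * z <= e * e by apply: ler_pM.
have ee : 0 < e * e by apply: mulr_gt0.
case: (leP 0 ab) => hab; first by apply: (@acute_flat_short bb aa ab); lra.
case: (leP 0 bc) => hbc; first by apply: (@acute_flat_short bb cc bc); lra.
have h : ab * bc <= e * e.
  have : bb * (- ac) >= 0 by apply: mulr_ge0; lra.
  lra.
have fin t uu : t * t <= e * e -> bb <= uu -> bb * uu - t * t <= e * e -> bb <= 2 * e.
  move=> h1 h2 h3.
  have h4 : bb * bb <= bb * uu by apply: ler_wpM2l.
  have /andP[] : - (2 * e) <= bb <= 2 * e.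
    by clear - h1 h3 h4 e0 ee; apply: sqr_le_abs; lra.
  by [].
case: (leP (- ab) e) => h1.
  apply: (fin ab aa) => //; last by lra.
  have -> : ab * ab = (- ab) * (- ab) by ring.
  by apply: ler_pM => //; lra.
apply: (fin bc cc) => //; last by lra.
have h3 : e * (- bc) <= (- ab) * (- bc) by apply: ler_wpM2r; lra.
have h4 : - bc <= e by rewrite -(ler_pM2l e0); lra.
have -> : bc * bc = (- bc) * (- bc) by ring.
by apply: ler_pM => //; lra.
Qed.

Lemma thin_opposite aa cc ac y :
  aa * cc - ac * ac = y * y -> 0 <= y -> y <= 1 / 1000 ->
  89 / 100 <= aa -> 89 / 100 <= cc -> aa <= 1 -> cc <= 1 -> ac <= 0 ->
  -1 <= ac /\ ac <= - (85/100).
Proof.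
move=> Eb y0 y1 a9 c9 a1 c1 ac0.
have hy : y * y <= 1 / 1000 * (1 / 1000) by apply: ler_pM.
have hy0 : 0 <= y * y by apply: mulr_ge0.
split.
  have h : aa * cc <= 1 * 1 by apply: ler_pM => //; lra.
  have /andP[] : - 1 <= ac <= 1 by apply: sqr_le_abs; lra.
  by [].
have h : (89/100) * (89/100) <= aa * cc by apply: ler_pM; lra.
have : (85/100) * (85/100) <= (- ac) * (- ac) by lra.
rewrite -!expr2 ler_pXn2r ?nnegrE //; lra.
Qed.

(** The chain is: a and c obtuse, then b short, then [ab] and [bc] small, so that sides longer than
    1 force [aa] and [cc] above 0.89. The last bounds express transversality: [x^2 = bb * cc - bc^2]
    is at least [(0.89 - 0.1) * bb], and likewise for [z]. *)
Lemma thin_gram_unit aa bb cc ab bc ac x y z :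
  planar_gram aa bb cc ab bc ac x y z ->
  x + y + z <= 1 / 1000 -> bb <= aa -> bb <= cc -> aa <= 1 -> cc <= 1 ->
  1 < aa + bb - 2 * ab -> 1 < bb + cc - 2 * bc -> 1 < aa + cc - 2 * ac ->
  [/\ (89 / 100 <= aa) && (89 / 100 <= cc), bb <= 2 / 1000, ac <= - (85 / 100),
      (- (5 / 100) <= ab) && (- (5 / 100) <= bc) &
      (bb <= 2 * (x * x)) && (bb <= 2 * (z * z))].
Proof.
move=> g we ba bc' a1 c1 sab sbc sac.
have [K1 K2 K3] := gram_cross g.
case: g => x0 y0 z0 a0 b0 c0 Ec Ea Eb _ _ _.
have [xe ye ze] : [/\ x <= 1 / 1000, y <= 1 / 1000 & z <= 1 / 1000].
  by clear - x0 y0 z0 we; split; lra.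
have [x0' y0' z0'] : [/\ 0 <= x, 0 <= y & 0 <= z] by rewrite !ltW.
have [ab2 bc2] : 2 * ab <= bb /\ 2 * bc <= bb.
  by clear - a1 c1 sab sbc; split; lra.
have ac0 : ac <= 0.
  case: (leP aa cc) => h.
    by apply: (@thin_obtuse aa bb cc ab ac y z).
  apply: (@thin_obtuse cc bb aa bc ac y x) => //; rewrite ?(ltW h) //.
  - by rewrite mulrC.
  - by rewrite mulrC.
  - by rewrite [cc + bb]addrC.
  - by rewrite [cc + aa]addrC.
have e0 : 0 < 1 / 1000 :> R by lra.
have b2 : bb <= 2 * (1 / 1000).
  exact: (@thin_short aa bb cc ab bc ac x z).
have {}b2 : bb <= 2 / 1000 by clear - b2; lra.
have /andP[ab1 _] : - (5/100) <= ab <= 5/100.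
  by apply: (@flat_dot_small ab bb aa z) => //; rewrite mulrC.
have /andP[bc1 _] : - (5/100) <= bc <= 5/100.
  by apply: (@flat_dot_small bc bb cc x).
have a9 : 89/100 <= aa by clear - ab1 sab b2; lra.
have c9 : 89/100 <= cc by clear - bc1 sbc b2; lra.
have [ac1 ac9] := thin_opposite Eb y0' ye a9 c9 a1 c1 ac0.
have ab10 : 10 * (ab * ab) <= bb.
  apply: (@transverse_dot cc bb bc ab ac y x) => //.
    by rewrite mulrC.
  by rewrite K3; ring.
have bc10 : 10 * (bc * bc) <= bb.
  exact: (@transverse_dot aa bb ab bc ac y z).
have hc : bb * (89/100) <= bb * cc by apply: ler_wpM2l.
have ha : bb * (89/100) <= bb * aa by apply: ler_wpM2l.
rewrite b2 ac9 ab1 bc1 a9 c9; split=> //.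
by clear - b0 hc ha ab10 bc10 Ec Ea; apply/andP; split; lra.
Qed.

Lemma gram_scale aa bb cc ab bc ac x y z t : 0 < t ->
  planar_gram aa bb cc ab bc ac x y z ->
  planar_gram (t * aa) (t * bb) (t * cc) (t * ab) (t * bc) (t * ac)
    (t * x) (t * y) (t * z).
Proof.
move=> t0 [x0 y0 z0 a0 b0 c0 Ec Ea Eb Ra Rb Rc].
have tt p q r s : p * q - r * r = s * s ->
    (t * p) * (t * q) - (t * r) * (t * r) = (t * s) * (t * s).
  move=> E; rewrite (_ : _ - _ = t * t * (p * q - r * r)); last by ring.
  by rewrite E; ring.
have rel p q r p' q' r' : p * p' + q * q' + r * r' = 0 ->
    (t * p) * (t * p') + (t * q) * (t * q') + (t * r) * (t * r') = 0.
  move=> E; rewrite (_ : _ + _ = t * t * (p * p' + q * q' + r * r')); last by ring.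
  by rewrite E mulr0.
by split; rewrite ?mulr_gt0 ?mulr_ge0 ?(ltW t0) //; do [exact: tt | exact: rel].
Qed.

(** Homogeneous form of [thin_gram_unit], obtained by scaling with [1 / L]; the scale [L] is that of
    squared norms and of areas. *)
Lemma thin_gram aa bb cc ab bc ac x y z L :
  planar_gram aa bb cc ab bc ac x y z ->
  1000 * (x + y + z) <= L -> bb <= aa -> bb <= cc -> aa <= L -> cc <= L ->
  L < aa + bb - 2 * ab -> L < bb + cc - 2 * bc -> L < aa + cc - 2 * ac ->
  [/\ (89 * L <= 100 * aa) && (89 * L <= 100 * cc), 1000 * bb <= 2 * L,
      100 * ac <= - (85 * L), (- (5 * L) <= 100 * ab) && (- (5 * L) <= 100 * bc) &
      (L * bb <= 2 * (x * x)) && (L * bb <= 2 * (z * z))].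
Proof.
move=> g we ba bc' aL cL sab sbc sac.
have L0 : 0 < L.
  have := gram_wa g; have := gram_wb g; have := gram_wc g.
  by clear - we; lra.
have [t [t0 tL]] : exists t, 0 < t /\ t * L = 1.
  by exists L^-1; rewrite invr_gt0 mulVf ?lt0r_neq0.
have sc p q : p <= q -> t * p <= t * q by rewrite ler_pM2l.
have sc' p q : p < q -> t * p < t * q by rewrite ltr_pM2l.
have := thin_gram_unit (gram_scale t0 g).
move: (sc _ _ we) (sc _ _ ba) (sc _ _ bc') (sc _ _ aL) (sc _ _ cL)
  (sc' _ _ sab) (sc' _ _ sbc) (sc' _ _ sac).
rewrite tL => h1 h2 h3 h4 h5 h6 h7 h8.
case.
- by clear - h1; lra.
- by [].
- by [].
- by [].
- by [].
- by clear - h6; lra.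
- by clear - h7; lra.
- by clear - h8; lra.
move=> /andP[r1 r2] r3 r4 /andP[r5 r6] /andP[r7 r8].
have us p q : t * p <= t * q -> p <= q by rewrite ler_pM2l.
clear - us t0 tL r1 r2 r3 r4 r5 r6 r7 r8.
have LE q : t * (L * q) = q by rewrite mulrA tL mul1r.
split; last first.
- apply/andP; split; apply: (us); rewrite LE.
    by rewrite -(ler_pM2l t0); clear - r7; lra.
  by rewrite -(ler_pM2l t0); clear - r8; lra.
- by apply/andP; split; apply: (us); clear - tL r5 r6; lra.
- by apply: us; clear - tL r4; lra.
- by apply: us; clear - tL r3; lra.
- by apply/andP; split; apply: (us); clear - tL r1 r2; lra.
Qed.

(* The weighted mean of the two sides at [b], with weights [x] and [z], exceeds
   [L] by at most [(1 + 2 y / (x + z)) |b|^2]. *)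
Lemma short_sides_bound aa bb cc ab bc ac x y z K m :
  planar_gram aa bb cc ab bc ac x y z -> 1000 <= K ->
  bb <= aa -> bb <= cc -> aa <= K * (x + y + z) -> cc <= K * (x + y + z) ->
  K * (x + y + z) < aa + bb - 2 * ab -> K * (x + y + z) < bb + cc - 2 * bc ->
  K * (x + y + z) < aa + cc - 2 * ac ->
  m <= aa + bb - 2 * ab -> m <= bb + cc - 2 * bc ->
  m <= K * (x + y + z) + K * x /\ m <= K * (x + y + z) + K * z.
Proof.
move=> g K1 ba bc' aL cL sab sbc sac mab mbc.
have x0 := gram_wa g; have y0 := gram_wb g; have z0 := gram_wc g.
have b0 := gram_bb g; have Rb := gram_relb g.
have K0 : 0 < K by clear - K1; lra.
have w0 : 0 < x + y + z by rewrite !addr_gt0.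
have L1 : 1000 * (x + y + z) <= K * (x + y + z) by rewrite ler_pM2r.
have [_ _ _ _ /andP[Lx Lz]] := thin_gram g L1 ba bc' aL cL sab sbc sac.
move: aL cL Lx Lz {g sab sbc sac L1}; set L := K * _ => aL cL Lx Lz.
have xz0 : 0 < x + z by rewrite addr_gt0.
(* In the weighted sum of the two sides, the relation paired with b turns [- 2 * (x * ab + z * bc)]
   into [2 * y * bb]. *)
have hm : (x + z) * m <= (x + z) * L + 2 * (x + y + z) * bb.
  have h1 : x * m <= x * (aa + bb - 2 * ab) by rewrite ler_pM2l.
  have h2 : z * m <= z * (bb + cc - 2 * bc) by rewrite ler_pM2l.
  have h3 : x * aa <= x * L by rewrite ler_pM2l.
  have h4 : z * cc <= z * L by rewrite ler_pM2l.
  have h5 : 0 <= x * bb by apply: mulr_ge0 => //; apply: ltW.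
  have h6 : 0 <= z * bb by apply: mulr_ge0 => //; apply: ltW.
  by clear - h1 h2 h3 h4 h5 h6 Rb; lra.
have Lxz : L * bb <= 2 * (x * z).
  case: (leP x z) => h.
    have : x * x <= x * z by rewrite ler_pM2l.
    by clear - Lx; lra.
  have : z * z <= x * z by rewrite ler_pM2r // ltW.
  by clear - Lz; lra.
have KK q : 0 <= q -> 2 * q <= K * K * q.
  move=> q0; apply: ler_wpM2r => //.
  have : 2 * 2 <= K * K by clear - K1; apply: ler_pM; lra.
  by clear; lra.
(* As [x + y + z] is [L / K], the excess [(x + z) * (m - L)] is at most [2 * L * bb / K]. For [u]
   equal to [x] or [z], the premise is the sum of [Lxz] and of [Lx] or [Lz]. *)
have fin u : 0 < u -> 2 * (L * bb) <= 2 * (u * (x + z)) -> m <= L + K * u.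
  move=> u0 hu.
  have q0 : 0 <= u * (x + z) by rewrite mulr_ge0 // ltW.
  rewrite -(ler_pM2l xz0) -(ler_pM2l K0).
  have h1 : K * ((x + z) * m) <= K * ((x + z) * L + 2 * (x + y + z) * bb).
    by rewrite ler_pM2l.
  have h2 := KK _ q0.
  have h3 : L * bb = K * (x + y + z) * bb by [].
  by clear - h1 h2 h3 hu; lra.
split; apply: fin => //.
  by clear - Lx Lxz; lra.
by clear - Lz Lxz; lra.
Qed.

End PlanarGram.

(** * Relabelling and shearing of Gram data *)

Lemma gram_swap_ab (R : realFieldType) (aa bb cc ab bc ac x y z : R) :
  planar_gram aa bb cc ab bc ac x y z -> planar_gram bb aa cc ab ac bc y x z.
Proof.
case=> *; split=> //; first by rewrite mulrC.
all: by rewrite [X in X + _]addrC.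
Qed.

(** The relation becomes x (a - b) + (x + y) b + z c = 0. Only the area spanned by the first and
    third vectors changes, and the cross identity for [cc * ab] completes its square to
    [(y + x)^2]. *)
Lemma gram_shear (R : realFieldType) (aa bb cc ab bc ac x y z : R) :
  planar_gram aa bb cc ab bc ac x y z ->
  0 <= aa + bb - 2 * ab ->
  planar_gram (aa + bb - 2 * ab) bb cc (ab - bb) bc (ac - bc) x (y + x) z.
Proof.
move=> g d0; have [_ _ K] := gram_cross g.
case: g => x0 y0 z0 a0 b0 c0 Ec Ea Eb Ra Rb Rc; split=> //.
- by rewrite addr_gt0.
- by rewrite -Ec; ring.
- rewrite (_ : _ - _ = (aa * cc - ac * ac) + (bb * cc - bc * bc)
    - 2 * (cc * ab) + 2 * (ac * bc)); last by ring.
  by rewrite Eb Ea K; ring.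
- rewrite (_ : _ + _ = (x * aa + y * ab + z * ac) - (x * ab + y * bb + z * bc)).
    by rewrite Ra Rb subr0.
  by ring.
- by rewrite -Rb; ring.
- by rewrite -Rc; ring.
Qed.

(** * The Euclidean inner product and norm in coordinates *)

Section Dot.
Context (R : realType).
Implicit Types u v w : 'cV[R]_3.

Lemma dotE u v : dot u v = u 0 0 * v 0 0 + u 1 0 * v 1 0 + u 2 0 * v 2 0.
Proof.
rewrite /dot !big_ord_recl big_ord0 addr0 addrA.
by congr (_ + _ * _ + _ * _); congr (_ _ 0); apply: val_inj.
Qed.

Lemma dotC u v : dot u v = dot v u.
Proof. by rewrite !dotE; ring. Qed.

Lemma dotDl u v w : dot (u + v) w = dot u w + dot v w.
Proof. by rewrite !dotE !mxE; ring. Qed.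

Lemma dotDr u v w : dot u (v + w) = dot u v + dot u w.
Proof. by rewrite !dotE !mxE; ring. Qed.

Lemma dotBl u v w : dot (u - v) w = dot u w - dot v w.
Proof. by rewrite !dotE !mxE; ring. Qed.

Lemma dotBr u v w : dot u (v - w) = dot u v - dot u w.
Proof. by rewrite !dotE !mxE; ring. Qed.

Lemma dotZl a u v : dot (a *: u) v = a * dot u v.
Proof. by rewrite !dotE !mxE; ring. Qed.

Lemma dotZr a u v : dot u (a *: v) = a * dot u v.
Proof. by rewrite !dotE !mxE; ring. Qed.

Lemma dot_ge0 v : 0 <= dot v v.
Proof. by rewrite dotE !addr_ge0 // -expr2 sqr_ge0. Qed.

Lemma dotBB u v : dot (u - v) (u - v) = dot u u + dot v v - 2 * dot u v.
Proof. by rewrite !dotE !mxE; ring. Qed.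

Lemma enorm_ge0 v : 0 <= enorm v.
Proof. exact: sqrtr_ge0. Qed.

Lemma sqr_enorm v : enorm v ^+ 2 = dot v v.
Proof. by rewrite sqr_sqrtr ?dot_ge0. Qed.

Lemma le_enorm u v : (enorm u <= enorm v) = (dot u u <= dot v v).
Proof. by rewrite ler_sqrt ?dot_ge0. Qed.

Lemma enormB u v : enorm (u - v) = enorm (v - u).
Proof. by rewrite /enorm !dotBB (dotC u v) addrC [dot u u + _]addrC addrC. Qed.

End Dot.

Lemma ord3_cover (i j k l : 'I_3) : uniq [:: i; j; k] -> [|| l == i, l == j | l == k].
Proof.
rewrite /= !inE -!val_eqE /=.
by case: i j k l => [[|[|[|i]]] ?] [[|[|[|j]]] ?] [[|[|[|k]]] ?] [[|[|[|l]]] ?].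
Qed.

Lemma big_ord3 (V : nmodType) (F : 'I_3 -> V) i j k : uniq [:: i; j; k] ->
  \sum_l F l = F i + F j + F k.
Proof.
move=> u; rewrite -big_enum (perm_big [:: i; j; k]) /=.
  by rewrite !big_cons big_nil addr0 addrA.
apply: uniq_perm => [||l]; rewrite ?enum_uniq // mem_enum !inE.
by rewrite (ord3_cover _ u).
Qed.

(** * Shears of balanced triples *)

Section Shear.
Context (R : realType).
Implicit Types (v : 'I_3 -> 'cV[R]_3) (w : 'I_3 -> R) (i j k : 'I_3).

Definition triple_gram v w i j k :=
  planar_gram (dot (v i) (v i)) (dot (v j) (v j)) (dot (v k) (v k))
    (dot (v i) (v j)) (dot (v j) (v k)) (dot (v i) (v k)) (w i) (w j) (w k).

(** Quantifying over all orderings lets any vector play the part of the short one; [balancedI]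
    recovers this from a single ordering, two transpositions generating all six. *)
Definition balanced v w := forall i j k, uniq [:: i; j; k] -> triple_gram v w i j k.

Lemma balancedI v w i j k : uniq [:: i; j; k] -> triple_gram v w i j k -> balanced v w.
Proof.
move=> u g.
have sab p q r : triple_gram v w p q r -> triple_gram v w q p r.
  by move=> /gram_swap_ab; rewrite /triple_gram (dotC (v q) (v p)).
have sac p q r : triple_gram v w p q r -> triple_gram v w r q p.
  move=> /gram_swap_ac.
  by rewrite /triple_gram (dotC (v r) (v p)) (dotC (v r) (v q)) (dotC (v q) (v p)).
move=> p q r; case/or3P: (ord3_cover p u) => /eqP->;
  case/or3P: (ord3_cover q u) => /eqP->;
  case/or3P: (ord3_cover r u) => /eqP->; rewrite /= ?inE ?eqxx ?orbT ?andbF //= => _.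
- exact/sab/sac/sab.
- exact/sab.
- exact/sab/sac.
- exact/sac/sab.
- exact/sac.
Qed.

Definition shear v i j : 'I_3 -> 'cV[R]_3 := fun l => if l == i then v i - v j else v l.
Definition shear_weight w i j : 'I_3 -> R := fun l => if l == j then w j + w i else w l.

Lemma balanced_shear v w i j k : uniq [:: i; j; k] ->
  balanced v w -> balanced (shear v i j) (shear_weight w i j).
Proof.
move=> u b; apply: (balancedI u); move: (b _ _ _ u).
move: u; rewrite /= !inE !negb_or andbT => /andP[/andP[ij ik] jk].
rewrite /triple_gram /shear /shear_weight !eqxx.
rewrite (negPf ij) !(eq_sym _ i) (negPf ij) (negPf ik).
rewrite (eq_sym k) (negPf jk) dotBB !dotBl => /gram_shear; apply.
by rewrite -dotBB dot_ge0.
Qed.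

Lemma sum_shear_weight w i j k : uniq [:: i; j; k] ->
  \sum_l shear_weight w i j l = \sum_l w l + w i.
Proof.
move=> u; rewrite !(big_ord3 _ u) /shear_weight.
move: u; rewrite /= !inE !negb_or andbT => /andP[/andP[ij ik] jk].
by rewrite (negPf ij) eqxx (eq_sym k) (negPf jk) addrA addrAC -!addrA.
Qed.

Lemma balanced_perm v w (p : 'S_3) : balanced v w -> balanced (v \o p) (w \o p).
Proof.
move=> b i j k u; apply: (b (p i) (p j) (p k)).
by rewrite -(map_inj_uniq (@perm_inj _ p)) in u.
Qed.

(** The inequality L^2 / A <= K of the overview, with the maximum replaced by a bound on each
    squared norm. *)
Definition size_bound K v := exists w, balanced v w /\
  forall l, dot (v l) (v l) <= K * \sum_l w l.

Lemma size_bound_perm K v (p : 'S_3) : size_bound K v -> size_bound K (v \o p).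
Proof.
move=> [w [b h]]; exists (w \o p); split; first exact: balanced_perm.
move=> l; rewrite /= (_ : \sum_l w (p l) = \sum_l w l) //.
by rewrite [RHS](reindex_inj (@perm_inj _ p)).
Qed.

Definition shortest v i j k :=
  dot (v i - v j) (v i - v j) <= dot (v i - v k) (v i - v k) /\
  dot (v i - v j) (v i - v j) <= dot (v j - v k) (v j - v k).

(** When the first shear breaks the bound, [v i] must be the short vector, with [v j] and [v k]
    nearly opposite. Then [v i - v j] is close to [v k], so the next subtraction joins the indices
    [i] and [k], and either direction restores the bound. *)
Lemma size_bound_two_steps K v i j k : 1000 <= K -> size_bound K v ->
  uniq [:: i; j; k] -> shortest v i j k ->
  size_bound K (shear v i j) \/
  forall i' j' k', uniq [:: i'; j'; k'] -> shortest (shear v i j) i' j' k' ->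
    size_bound K (shear (shear v i j) i' j').
Proof.
move=> K1 [w [b hw]] u [m1 m2].
have K0 : 0 < K by clear - K1; lra.
have gijk := b _ _ _ u.
move: (u); rewrite /= !inE !negb_or andbT => /andP[/andP[ij ik] jk].
have ujik : uniq [:: j; i; k] by rewrite /= !inE !negb_or [j == i]eq_sym ij jk ik.
have uikj : uniq [:: i; k; j] by rewrite /= !inE !negb_or [k == j]eq_sym ij jk ik.
have x0 := gram_wa gijk; have y0 := gram_wb gijk; have z0 := gram_wc gijk.
have b' := balanced_shear u b.
have wsum : \sum_l w l = w i + w j + w k by apply: big_ord3.
have wsum' : \sum_l shear_weight w i j l = w i + w j + w k + w i.
  by rewrite (sum_shear_weight _ u) wsum.
have shE : [/\ shear v i j i = v i - v j, shear v i j j = v j & shear v i j k = v k].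
  by rewrite /shear eqxx ![_ == i]eq_sym (negPf ij) (negPf ik).
(* The total weight has grown by [w i], so only the new vector can violate the bound. *)
case: (leP (dot (v i - v j) (v i - v j)) (K * (w i + w j + w k + w i))) => hm.
  left; exists (shear_weight w i j); split=> // l; rewrite wsum'.
  case: shE => Ei Ej Ek.
  have Kw : K * (w i + w j + w k) <= K * (w i + w j + w k + w i).
    by rewrite ler_pM2l //; clear - x0; lra.
  case/or3P: (ord3_cover l u) => /eqP->; rewrite ?Ei ?Ej ?Ek //;
    by apply: le_trans Kw; rewrite -wsum.
right.
have hi := hw i; have hj := hw j; have hk := hw k.
rewrite wsum in hi hj hk.
have [L [LE L1]] : exists L, L = K * (w i + w j + w k) /\ 1000 * (w i + w j + w k) <= L.
  exists (K * (w i + w j + w k)); split=> //; apply: ler_wpM2r => //.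
  by clear - x0 y0 z0; lra.
rewrite mulrDr -LE in hm.
rewrite -LE in hi hj hk.
have Kx : 0 < K * w i by rewrite mulr_gt0.
have s1 : L < dot (v i - v j) (v i - v j) by clear - hm Kx; lra.
have s2 := lt_le_trans s1 m1; have s3 := lt_le_trans s1 m2.
rewrite !dotBB in m1 m2 s1 s2 s3 hm.
have gikj := b _ _ _ uikj; have gjik := b _ _ _ ujik.
have wE1 : w i + w k + w j = w i + w j + w k by rewrite addrAC.
have wE2 : w j + w i + w k = w i + w j + w k by rewrite [w j + _]addrC.
(* If [v j], or below [v k], were the shortest vector, the shortest side would be at most
   [L + K * w i], against [hm]. *)
have notj : dot (v j) (v j) <= dot (v i) (v i) ->
    dot (v j) (v j) <= dot (v k) (v k) -> False.
  move=> ji jk'.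
  have := short_sides_bound gijk K1 ji jk'; rewrite -LE => H.
  have [] := H _ hi hk s1 s3 s2 (lexx _) m2.
  by clear - hm; lra.
have notk : dot (v k) (v k) <= dot (v i) (v i) ->
    dot (v k) (v k) <= dot (v j) (v j) -> False.
  move=> ki kj.
  have := short_sides_bound gikj K1 ki kj; rewrite wE1 -LE (dotC (v k)) => H.
  rewrite [dot (v j) _ + dot (v k) _]addrC in s3 m2.
  have [] := H _ hi hj s2 s3 s1 m1 m2.
  by clear - hm; lra.
have [si sk] : dot (v i) (v i) <= dot (v j) (v j) /\ dot (v i) (v i) <= dot (v k) (v k).
  case: (leP (dot (v j) (v j)) (dot (v k) (v k))) => [h|/ltW h]; split; rewrite leNgt;
    apply/negP => /ltW h'.
  - exact: notj.
  - by apply: notj => //; apply: le_trans h'.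
  - by apply: notk => //; apply: le_trans h'.
  - exact: notk.
have [mj mk] : dot (v i) (v i) + dot (v j) (v j) - 2 * dot (v i) (v j) <= L + K * w j /\
    dot (v i) (v i) + dot (v j) (v j) - 2 * dot (v i) (v j) <= L + K * w k.
  have := short_sides_bound gjik K1 si sk; rewrite wE2 -LE (dotC (v j)).
  rewrite [dot (v j) _ + dot (v i) _]addrC => H.
  exact: H hj hk s1 s2 s3 (lexx _) m1.
have := thin_gram gjik; rewrite wE2 (dotC (v j)) [dot (v j) _ + dot (v i) _]addrC => H.
have {H}[/andP[r1 r2] r3 r4 /andP[r5 r6] _] := H _ L1 si sk hj hk s1 s2 s3.
move=> i' j' k' u' [n1 n2].
have cij := dotC (v j) (v i); have cik := dotC (v k) (v i); have cjk := dotC (v k) (v j).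
have [wi' wk'] : shear_weight w i j i = w i /\ shear_weight w i j k = w k.
  by rewrite /shear_weight (negPf ij) (eq_sym k) (negPf jk).
have := balanced_shear u' b'; have := sum_shear_weight (shear_weight w i j) u'.
rewrite wsum'.
case: shE => Ei Ej Ek.
have Kk : 0 < K * w k by rewrite mulr_gt0.
(* The estimates even give about [L / 2], whereas both new sides ending at [v j] have squared length
   above [3 * L]; this excludes four of the six orderings below. *)
have small : dot (v i - v j - v k) (v i - v j - v k) <= L.
  rewrite !dotBB !dotBl.
  by clear - hj hk hi r3 r4 r5 r6; lra.
move: u' n1 n2; case/or3P: (ord3_cover i' u) => /eqP->;
  case/or3P: (ord3_cover j' u) => /eqP->;
  case/or3P: (ord3_cover k' u) => /eqP->; rewrite /= ?inE ?eqxx ?orbT ?andbF //= => _;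
  rewrite ?Ei ?Ej ?Ek ?wi' ?wk' => n1 n2 ws bs.
- exfalso; move: n1 n2; rewrite !(dotBB, dotBl) ?cij ?cik ?cjk.
  by clear - s1 s2 s3 r1 r2 r3 r4 r5 r6 hi hj hk; lra.
- exists (shear_weight (shear_weight w i j) i k); split=> // l; rewrite ws !mulrDr.
  have LL : L <= K * w i + K * w j + K * w k by rewrite LE !mulrDr.
  rewrite /shear; case/or3P: (ord3_cover l u) => /eqP->.
  - rewrite !eqxx (eq_sym k) (negPf ik); clear - LL small Kx; lra.
  - rewrite !(eq_sym j) (negPf ij); clear - LL hj Kx; lra.
  - rewrite !(eq_sym k) (negPf ik); clear - LL hk Kx; lra.
- exfalso; move: n1 n2; rewrite !(dotBB, dotBl, dotBr) ?cij ?cik ?cjk.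
  by clear - s1 s2 s3 r1 r2 r3 r4 r5 r6 hi hj hk; lra.
- exfalso; move: n1 n2; rewrite !(dotBB, dotBl, dotBr) ?cij ?cik ?cjk.
  by clear - s1 s2 s3 r1 r2 r3 r4 r5 r6 hi hj hk; lra.
(* Here the long vector [v i - v j] survives; the gain [w k] in total weight absorbs its excess, by
   [mk]. *)
- exists (shear_weight (shear_weight w i j) k i); split=> // l; rewrite ws !mulrDr.
  have LL : L = K * w i + K * w j + K * w k by rewrite LE !mulrDr.
  rewrite /shear; case/or3P: (ord3_cover l u) => /eqP->.
  - rewrite !eqxx (negPf ik) dotBB; clear - LL mk Kx; lra.
  - rewrite (negPf jk) (eq_sym j) (negPf ij); clear - LL hj Kx Kk; lra.
  - rewrite !eqxx (eq_sym k) (negPf ik).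
    rewrite (_ : v k - _ = - (v i - v j - v k)); last by rewrite [RHS]opprB.
    rewrite (_ : dot (- _) _ = dot (v i - v j - v k) (v i - v j - v k)).
      by clear - LL small Kx Kk; lra.
    by rewrite -scaleN1r dotZl dotZr; clear; lra.
- exfalso; move: n1 n2; rewrite !(dotBB, dotBl, dotBr) ?cij ?cik ?cjk.
  by clear - s1 s2 s3 r1 r2 r3 r4 r5 r6 hi hj hk; lra.
Qed.
End Shear.

(** * Convex sets and plane coordinates *)

Lemma infinite_set_unbounded (S : set nat) :
  (forall N, exists2 s, (N <= s)%N & S s) -> infinite_set S.
Proof.
move=> h /finite_seqP[r Sr]; have [s + Ss] := h (\max_(i <- r) i).+1.
by rewrite ltnNge leq_bigmax_seq //; move: Ss; rewrite Sr.
Qed.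

Section Convex.
Context (R : realType) (C : set 'cV[R]_3).
Hypothesis C_convex : convex_set (C : set (convex_lmodType 'cV[R]_3)).

Lemma convex_comb (t : R) (x y : 'cV[R]_3) :
  0 <= t -> t <= 1 -> C x -> C y -> C (t *: x + (1 - t) *: y).
Proof.
move=> t0 t1 Cx Cy.
have := C_convex (Itv01 t0 t1) (mem_set Cx) (mem_set Cy).
by rewrite inE.
Qed.

Lemma convex_sym_segment (x : 'cV[R]_3) (t : R) :
  `|t| <= 1 -> C x -> C (- x) -> C (t *: x).
Proof.
rewrite ler_norml => /andP[t1 t2] Cx CNx.
have -> : t *: x = ((1 + t) / 2) *: x + (1 - (1 + t) / 2) *: - x.
  by rewrite scalerN -scalerBl; congr (_ *: _); lra.
by apply: convex_comb => //; lra.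
Qed.

(** The point is the midpoint of [2 s x] and [2 t y], which lie on the diagonals from [- x] to [x]
    and from [- y] to [y]. *)
Lemma convex_sym_parallelogram (x y : 'cV[R]_3) (s t : R) :
  `|s| <= 1 / 2 -> `|t| <= 1 / 2 -> C x -> C (- x) -> C y -> C (- y) ->
  C (s *: x + t *: y).
Proof.
move=> s1 t1 Cx CNx Cy CNy.
have -> : s *: x + t *: y =
    (1 / 2) *: ((2 * s) *: x) + (1 - 1 / 2) *: ((2 * t) *: y).
  by rewrite !scalerA; congr (_ *: _ + _ *: _); lra.
apply: convex_comb; try lra; apply: convex_sym_segment => //.
  by rewrite normrM ger0_norm //; lra.
by rewrite normrM ger0_norm //; lra.
Qed.

End Convex.

Lemma halfspace_convex (R : realType) (e : 'cV[R]_3) (B : R) :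
  convex_set ([set v | dot v e <= B] : set (convex_lmodType 'cV[R]_3)).
Proof.
move=> x y l; rewrite !inE /= => hx hy.
have l0 : 0 <= l%:num by [].
have l1 : l%:num <= 1 by [].
rewrite (_ : conv l x y = l%:num *: (x : 'cV[R]_3) + (1 - l%:num) *: (y : 'cV[R]_3)) //.
rewrite dotDl !dotZl.
have : l%:num * dot x e <= l%:num * B by apply: ler_wpM2l.
have : (1 - l%:num) * dot y e <= (1 - l%:num) * B by apply: ler_wpM2l => //; rewrite subr_ge0.
by lra.
Qed.

Section Plane.
Context (R : realType).
Implicit Types u v a b X r : 'cV[R]_3.

Lemma dot_gt0 X : 0 < X 0 0 -> 0 < dot X X.
Proof.
move=> h; rewrite dotE -!expr2.
have : 0 < X 0 0 ^+ 2 by rewrite exprn_gt0.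
have := sqr_ge0 (X 1 0); have := sqr_ge0 (X 2 0); lra.
Qed.

Lemma dot_projP X u v : 0 < dot X X ->
  dot (projP X u) (projP X v) = dot u v - dot u X * dot v X / dot X X.
Proof.
move=> h; rewrite /projP /projD !(dotBl, dotBr, dotZl, dotZr) (dotC X v).
by field; rewrite lt0r_neq0.
Qed.

Lemma dot_projPX X u : 0 < dot X X -> dot (projP X u) X = 0.
Proof.
by move=> h; rewrite /projP /projD dotBl dotZl divfK ?subrr // lt0r_neq0.
Qed.

Lemma col3P u v : u 0 0 = v 0 0 -> u 1 0 = v 1 0 -> u 2 0 = v 2 0 -> u = v.
Proof.
move=> h0 h1 h2; apply/colP => i.
have /or3P[] := @ord3_cover 0 1 2 i isT; by move/eqP->.
Qed.

(** [D] is the determinant of a, b, X and its square is their Gram determinant, hence nonzero.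
    Cramer's rule writes [D] times r as a combination of cross products with coefficients [dot r a],
    [dot r b], [dot r X]. *)
Lemma orthogonal_frame_eq0 X a b r : 0 < dot X X ->
  0 < dot a a * dot b b - dot a b ^+ 2 ->
  dot a X = 0 -> dot b X = 0 -> dot r X = 0 -> dot r a = 0 -> dot r b = 0 -> r = 0.
Proof.
move=> X0 ab0 aX bX rX ra rb.
pose D := a 0 0 * (b 1 0 * X 2 0 - b 2 0 * X 1 0)
  - a 1 0 * (b 0 0 * X 2 0 - b 2 0 * X 0 0) + a 2 0 * (b 0 0 * X 1 0 - b 1 0 * X 0 0).
have DD : D ^+ 2 = (dot a a * dot b b - dot a b ^+ 2) * dot X X
    - dot a X * (dot a X * dot b b - 2 * dot a b * dot b X) - dot b X ^+ 2 * dot a a.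
  by rewrite /D !dotE; ring.
have D0 : D != 0.
  apply/eqP => D0; move: DD; rewrite D0 aX bX expr0n /= !mul0r !subr0.
  by apply/eqP; rewrite eq_sym lt0r_neq0 // mulr_gt0.
apply: col3P; rewrite mxE; apply: (mulfI D0); rewrite mulr0.
- transitivity (dot r a * (b 1 0 * X 2 0 - b 2 0 * X 1 0)
    + dot r b * (X 1 0 * a 2 0 - X 2 0 * a 1 0)
    + dot r X * (a 1 0 * b 2 0 - a 2 0 * b 1 0)); first by rewrite /D !dotE; ring.
  by rewrite ra rb rX !mul0r !addr0.
- transitivity (dot r a * (b 2 0 * X 0 0 - b 0 0 * X 2 0)
    + dot r b * (X 2 0 * a 0 0 - X 0 0 * a 2 0)
    + dot r X * (a 2 0 * b 0 0 - a 0 0 * b 2 0)); first by rewrite /D !dotE; ring.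
  by rewrite ra rb rX !mul0r !addr0.
- transitivity (dot r a * (b 0 0 * X 1 0 - b 1 0 * X 0 0)
    + dot r b * (X 0 0 * a 1 0 - X 1 0 * a 0 0)
    + dot r X * (a 0 0 * b 1 0 - a 1 0 * b 0 0)); first by rewrite /D !dotE; ring.
  by rewrite ra rb rX !mul0r !addr0.
Qed.

(** Coordinates by Cramer's rule. Up to sign, [s * z] is the area spanned by v and b, so Lagrange's
    identity gives [dot v v * dot b b - (s * z)^2 = (dot v b)^2]; similarly for [t] with a. *)
Lemma plane_coordinates X a b v (z : R) : 0 < dot X X -> 0 < z ->
  dot a a * dot b b - dot a b * dot a b = z * z ->
  dot a X = 0 -> dot b X = 0 -> dot v X = 0 ->
  exists s t, [/\ v = s *: a + t *: b,
    (s * z) ^+ 2 <= dot v v * dot b b & (t * z) ^+ 2 <= dot v v * dot a a].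
Proof.
move=> X0 z0 E aX bX vX.
have zz0 : z * z != 0 by rewrite mulf_neq0 ?lt0r_neq0.
pose s := (dot v a * dot b b - dot v b * dot a b) / (z * z).
pose t := (dot v b * dot a a - dot v a * dot a b) / (z * z).
have vE : v = s *: a + t *: b.
  apply/eqP; rewrite -subr_eq0; apply/eqP.
  apply: (@orthogonal_frame_eq0 X a b) => //.
  - by rewrite expr2 E mulr_gt0.
  - by rewrite dotBl dotDl !dotZl aX bX vX !mulr0 addr0 subr0.
  - rewrite dotBl dotDl !dotZl (dotC b a) /s /t -E; field.
    by rewrite E.
  - rewrite dotBl dotDl !dotZl /s /t -E; field.
    by rewrite E.
have vv : dot v v = s * s * dot a a + 2 * s * t * dot a b + t * t * dot b b.
  by rewrite vE !(dotDl, dotDr, dotZl, dotZr) (dotC b a); ring.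
exists s, t; split => //; rewrite vv -subr_ge0.
- rewrite (_ : _ - _ = (s * dot a b + t * dot b b) ^+ 2) ?sqr_ge0 //.
  by rewrite exprMn [z ^+ 2]expr2 -E; ring.
- rewrite (_ : _ - _ = (t * dot a b + s * dot a a) ^+ 2) ?sqr_ge0 //.
  by rewrite exprMn [z ^+ 2]expr2 -E; ring.
Qed.

End Plane.

(** Gram data of the standard basis projected orthogonally to the unit vector (p, q, r), whose
    coordinates serve as weights. *)
Lemma gram_of_unit (R : realFieldType) (p q r : R) :
  0 < p -> 0 < q -> 0 < r -> p * p + q * q + r * r = 1 ->
  planar_gram (1 - p * p) (1 - q * q) (1 - r * r) (- (p * q)) (- (q * r)) (- (p * r)) p q r.
Proof.
move=> p0 q0 r0 E.
have [pp qq rr] : [/\ 0 <= p * p, 0 <= q * q & 0 <= r * r].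
  by rewrite -!expr2 !sqr_ge0.
split=> //; try by clear - E pp qq rr; lra.
all: by rewrite -E; ring.
Qed.

Lemma exists_large_weight (R : realFieldType) (w : 'I_3 -> R) :
  exists k, \sum_l w l <= 3 * w k.
Proof.
rewrite (@big_ord3 _ w 0 1 2) //.
case: (leP (w 0) (w 1)) => h1; case: (leP (w 1) (w 2)) => h2;
  [exists 2 | exists 1 | case: (leP (w 0) (w 2)) => h3; [exists 2 | exists 0] | exists 0];
  by lra.
Qed.

(** * The algorithm *)

Section Algorithm.
Context (R : realType) (X : 'cV[R]_3).
Implicit Types (G F : 'M[int]_3) (w : 'I_3 -> R).

Definition gproj G : 'I_3 -> 'cV[R]_3 := fun i => projP X (gcol R G i).

Lemma projPB u v : projP X (u - v) = projP X u - projP X v.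
Proof.
by apply/colP => r; rewrite /projP /projD dotBl !mxE; ring.
Qed.

Lemma gproj_sub_col G i j : gproj (sub_col i j G) = shear (gproj G) i j.
Proof.
apply: funext => l; rewrite /gproj /shear; case: eqP => [->|/eqP li].
  rewrite -projPB; congr projP; apply/colP => r.
  by rewrite !mxE eqxx intrB.
by congr projP; apply/colP => r; rewrite !mxE (negPf li).
Qed.

Lemma gproj_col_perm F (p : 'S_3) : gproj (col_perm p F) = gproj F \o p.
Proof.
by apply: funext => l; congr projP; apply/colP => r; rewrite !mxE.
Qed.

(** Merges the three kinds of subtraction, ties included, into one shear along a shortest side
    followed by a relabelling. *)
Lemma sva_stepP G G' : sva_step X G G' ->
  exists i j k (p : 'S_3), [/\ uniq [:: i; j; k], shortest (gproj G) i j k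
    & gproj G' = shear (gproj G) i j \o p].
Proof.
move=> [F [p [sF -> _ _]]].
have gsym i j : gdist X G i j = gdist X G j i by rewrite /gdist enormB.
have short i j k : gdist X G i j <= gdist X G i k -> gdist X G i j <= gdist X G j k ->
    shortest (gproj G) i j k by rewrite /gdist !le_enorm.
have [m10 m21 m20] : [/\ delta_min X G <= gdist X G 1 0,
    delta_min X G <= gdist X G 2 1 & delta_min X G <= gdist X G 2 0].
  rewrite /delta_min; move: (gdist _ _ _ _) (gdist _ _ _ _) (gdist _ _ _ _) => x y z.
  by rewrite !ge_min !lexx !orbT.
case: sF => m.
- exists 1, 0, 2, p; split=> //; last by rewrite gproj_col_perm gproj_sub_col.
  by apply: short; rewrite -m ?(gsym 1 2) ?(gsym 0 2).
- exists 2, 1, 0, p; split=> //; last by rewrite gproj_col_perm gproj_sub_col.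
  by apply: short; rewrite -m.
- exists 2, 0, 1, p; split=> //; last by rewrite gproj_col_perm gproj_sub_col.
  by apply: short; rewrite -m ?(gsym 0 1).
Qed.

Lemma sva_run_size_bound (G : nat -> 'M[int]_3) K : 1000 <= K ->
  sva_run X G -> size_bound K (gproj (G 0%N)) ->
  forall N, exists2 s, (N <= s)%N & size_bound K (gproj (G s)).
Proof.
move=> K1 [_ run] b0; elim=> [|N [s Ns bs]]; first by exists 0%N.
have [i [j [k [p [u sh E]]]]] := sva_stepP (run s).
case: (size_bound_two_steps K1 bs u sh) => [b1|b2].
  by exists s.+1 => //; rewrite E; apply: size_bound_perm.
exists s.+2; first by rewrite ltnW.
have [i' [j' [k' [p' [u' sh' ->]]]]] := sva_stepP (run s.+1).
apply: size_bound_perm; rewrite E in sh' *.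
(* The second shear acts on relabelled columns; moving [p] outside makes it a shear of the
   unpermuted triple at [p i'] and [p j']. *)
rewrite (_ : shear _ i' j' = shear (shear (gproj (G s)) i j) (p i') (p j') \o p).
  apply: size_bound_perm; apply: (b2 _ _ (p k')) => //.
  by rewrite -(map_inj_uniq (@perm_inj _ p)) in u'.
by apply: funext => l; rewrite /= {1 3}/shear (inj_eq perm_inj).
Qed.

Hypotheses (X0 : 0 < X 0 0) (X1 : 0 < X 1 0) (X2 : 0 < X 2 0).

Let XX0 : 0 < dot X X := dot_gt0 X0.

(** The weights are the coordinates of [X] divided by its norm; [K] depends on [X] and is taken
    large enough for the initial triple. *)
Lemma size_bound_start : exists2 K, 1000 <= K & size_bound K (gproj 1%:M).
Proof.
have [t [t0 tt]] : exists t, 0 < t /\ t * t = (dot X X)^-1.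
  exists (Num.sqrt (dot X X)^-1); rewrite sqrtr_gt0 invr_gt0; split=> //.
  by rewrite -expr2 sqr_sqrtr // invr_ge0 ltW.
pose w i := t * X i 0.
have b : balanced (gproj 1%:M) w.
  apply: (@balancedI _ _ _ 0 1 2) => //.
  have gE i : dot (gcol R 1%:M i) X = X i 0.
    have /or3P[] := @ord3_cover 0 1 2 i isT; move/eqP->;
    by rewrite dotE !mxE /= !(mul0r, mul1r, add0r, addr0).
  rewrite /triple_gram /gproj !dot_projP // !gE.
  have := @gram_of_unit _ (w 0) (w 1) (w 2).
  rewrite /w !mulr_gt0 //.
  have ww i j : t * X i 0 * (t * X j 0) = X i 0 * X j 0 / dot X X.
    by rewrite -tt; ring.
  rewrite !ww => /(_ isT isT isT) H.
  have := H; rewrite !dotE !mxE /= !(mul0r, mul1r, add0r, addr0, mulr0, mulr1).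
  apply; rewrite -!mulrDl -dotE divff // lt0r_neq0 //.
have w0 i : 0 < w i.
  have /or3P[] := @ord3_cover 0 1 2 i isT; move/eqP->; by rewrite mulr_gt0.
have W0 : 0 < \sum_l w l.
  by rewrite (@big_ord3 _ _ 0 1 2) // !addr_gt0.
pose B := \sum_l dot (gproj 1%:M l) (gproj 1%:M l).
exists (Num.max 1000 (B / \sum_l w l)); first by rewrite le_max lexx.
exists w; split=> // l.
apply: (@le_trans _ _ B).
  by rewrite /B (bigD1 l) //= lerDl sumr_ge0 // => i _; rewrite dot_ge0.
by rewrite -ler_pdivrMr // le_max lexx orbT.
Qed.

(** A point of the disk has coordinates at most 1/2 in absolute value on the two vectors other than
    the [k]-th, since each coordinate times [w k] is at most [w k / (2 * M)] times [M]. *)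
Lemma inradius_ge G w k M : balanced (gproj G) w -> 0 < M ->
  (forall i, dot (gproj G i) (gproj G i) <= M ^+ 2) -> w k / (2 * M) <= inradius X G.
Proof.
move=> b M0 hM.
have [i [j u]] : exists i j, uniq [:: i; j; k].
  have /or3P[] := @ord3_cover 0 1 2 k isT; move/eqP->.
  - by exists 1, 2.
  - by exists 0, 2.
  - by exists 0, 1.
have g := b _ _ _ u; have z0 := gram_wc g; have E := gram_areac g.
set a := gproj G i in g E; set c := gproj G j in g E.
have aX : dot a X = 0 by apply: dot_projPX.
have cX : dot c X = 0 by apply: dot_projPX.
have a0 : 0 < dot a a.
  rewrite lt_neqAle dot_ge0 andbT; apply/eqP => a0.
  have : 0 < w k * w k by rewrite mulr_gt0.
  by rewrite -E -a0 mul0r sub0r oppr_gt0 ltNge -expr2 sqr_ge0.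
have na0 : 0 < enorm a by rewrite sqrtr_gt0.
apply: ub_le_sup.
  (* The supremum needs a bounded set: the hexagon lies in the half-space [dot v a <= B], tested at
     the point of norm [r] in the direction of [a]. *)
  pose B := \sum_l `|dot (gproj G l) a|.
  exists (B / enorm a) => r [r0 hr].
  have : dot ((r / enorm a) *: a) a <= B.
    have : hexagon X G ((r / enorm a) *: a).
      apply: hr; split; rewrite /= /planeP /= ?dotZl ?aX ?mulr0 //.
      rewrite /enorm dotZl dotZr mulrA -expr2 sqrtrM ?sqr_ge0 // sqrtr_sqr.
      by rewrite ger0_norm ?divr_ge0 ?(ltW na0) // -/(enorm a) divfK ?lt0r_neq0.
    apply: (smallest_sub (@halfspace_convex _ a B)) => v [l [] ->] /=.
      by rewrite /B (bigD1 l) //= (le_trans (ler_norm _)) // lerDl sumr_ge0.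
    rewrite -scaleN1r dotZl mulN1r /B (bigD1 l) //=.
    by rewrite (le_trans (ler_norm _)) // normrN lerDl sumr_ge0.
  rewrite dotZl -sqr_enorm ler_pdivlMr // expr2 mulrA divfK ?lt0r_neq0 //.
split; first by rewrite divr_ge0 ?mulr_ge0 ?ltW.
move=> v [vX /= vr].
have [s [t [vE hs ht]]] := plane_coordinates XX0 z0 E aX cX vX.
have half q n : (q * w k) ^+ 2 <= dot v v * n -> n <= M ^+ 2 -> 0 <= n -> `|q| <= 1 / 2.
  move=> hq hn n0.
  have vv : dot v v <= (w k / (2 * M)) ^+ 2.
    by rewrite -sqr_enorm ler_pXn2r // nnegrE ?enorm_ge0 // divr_ge0 ?mulr_ge0 ?ltW.
  have : (q * w k) ^+ 2 <= (w k / 2) ^+ 2.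
    apply: (le_trans hq); rewrite (_ : (w k / 2) ^+ 2 = (w k / (2 * M)) ^+ 2 * M ^+ 2).
      by apply: ler_pM => //; apply: dot_ge0.
    by field; rewrite lt0r_neq0.
  have wk2 : 0 <= w k / 2 by rewrite divr_ge0 // ltW.
  rewrite -ler_sqrt ?sqr_ge0 // !sqrtr_sqr normrM (ger0_norm wk2).
  by rewrite (gtr0_norm z0) mulrC ler_pM2l // div1r.
move=> C [CC sub]; rewrite vE; apply: convex_sym_parallelogram => //.
- exact: (half _ _ hs (hM j) (dot_ge0 _)).
- exact: (half _ _ ht (hM i) (dot_ge0 _)).
- by apply: sub; exists i; left.
- by apply: sub; exists i; right.
- by apply: sub; exists j; left.
- by apply: sub; exists j; right.
Qed.

(** With [k] of largest weight, the ratio is at most [2 * M^2 / w k], where [M^2] is at most [K]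
    times the total weight, itself at most [3 * w k]. *)
Lemma size_bound_ratio G K : size_bound K (gproj G) ->
  0 < inradius X G /\ max_norm X G / inradius X G <= 6 * K.
Proof.
move=> [w [b h]].
have u012 : uniq [:: 0; 1; 2 : 'I_3] by [].
have g := b _ _ _ u012.
have w0 := gram_wa g; have w1 := gram_wb g; have w2 := gram_wc g.
have [k wk] := exists_large_weight w.
have k0 : 0 < w k.
  have /or3P[] := @ord3_cover 0 1 2 k isT; by move/eqP->.
set M := max_norm X G.
have Mi l : enorm (gproj G l) <= M.
  have /or3P[] := @ord3_cover 0 1 2 l isT; move/eqP->;
  by rewrite /M /max_norm !le_max lexx ?orbT.
have MM : M ^+ 2 <= K * \sum_l w l.
  have max_sqr p q c : p ^+ 2 <= c -> q ^+ 2 <= c -> Num.max p q ^+ 2 <= c :> R.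
    by rewrite maxEle; case: ifP.
  by apply: (max_sqr); [apply: (max_sqr)|]; rewrite sqr_enorm; apply: h.
have M0 : 0 < M.
  apply: (@lt_le_trans _ _ (enorm (gproj G 0))) => //.
  rewrite sqrtr_gt0 lt_neqAle dot_ge0 andbT; apply/eqP => a0.
  have : 0 < w 2 * w 2 by rewrite mulr_gt0.
  by rewrite -(gram_areac g) -a0 mul0r sub0r oppr_gt0 ltNge -expr2 sqr_ge0.
have rho : w k / (2 * M) <= inradius X G.
  apply: inradius_ge => // i; rewrite -sqr_enorm ler_pXn2r // nnegrE ?enorm_ge0 //.
  exact: ltW.
have r0 : 0 < w k / (2 * M) by rewrite divr_gt0 ?mulr_gt0.
have rho0 := lt_le_trans r0 rho; split=> //.
have W0 : 0 < \sum_l w l by rewrite (big_ord3 w u012) !addr_gt0.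
have K0 : 0 < K.
  by rewrite -(pmulr_lgt0 _ W0); apply: lt_le_trans MM; rewrite exprn_gt0.
rewrite ler_pdivrMr //; apply: (@le_trans _ _ (6 * K * (w k / (2 * M)))); last first.
  by rewrite ler_pM2l // mulr_gt0.
rewrite mulrA ler_pdivlMr ?mulr_gt0 //.
have : K * \sum_l w l <= K * (3 * w k) by rewrite ler_pM2l.
by move: MM; rewrite expr2; lra.
Qed.

End Algorithm.

(* The quotient is taken in \bar R, where a positive number divided by 0 is +oo. *)
Theorem theorem3 (R : realType) (X : 'cV[R]_3) (G : nat -> 'M[int]_3)
  (hind : rationally_independent X)
  (hX0 : 0 < X 0 0) (hX01 : X 0 0 < X 1 0) (hX12 : X 1 0 < X 2 0)
  (hG : sva_run X G) :
  exists S : set nat, infinite_set S /\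
    (ereal_sup [set (max_norm X (G s))%:E / (inradius X (G s))%:E | s in S]
       < +oo)%E.
Proof.
have hX1 := lt_trans hX0 hX01; have hX2 := lt_trans hX1 hX12.
have [K K1 b0] := size_bound_start hX0 hX1 hX2.
exists [set s | size_bound K (gproj X (G s))]; split.
  apply: infinite_set_unbounded; apply: sva_run_size_bound => //.
  by case: hG => ->.
apply: (@le_lt_trans _ _ (6 * K)%:E); last by rewrite ltry.
apply: ge_ereal_sup => _ [s bs <-].
have [r0 hr] := size_bound_ratio hX0 bs.
(* Positivity of the inradius makes the extended quotient a real one. *)
by rewrite inver gt_eqF // -EFinM lee_fin.
Qed.
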